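(* The class $\mathrm{RAND}_{\mathrm{comp}}$ of computably random sequences is a $\Pi^0_3$-class, but not a $\boldsymbol\Sigma^0_3$-class.
   Context: $\mathbf{C}=\{0,1\}^{\mathbb N}$; $A\upharpoonright n$ is the first $n$ bits of $A$. A martingale is $d:\{0,1\}^*\to[0,\infty)$ with $2d(w)=d(w0)+d(w1)$ for all $w$; $S^\infty[d]=\{A:\limsup_n d(A\upharpoonright n)=\infty\}$. $A$ is computably random if $A\notin S^\infty[d]$ for every computable martingale $d$. $\Pi^0_3$ refers to the lightface arithmetical hierarchy of subsets of $\mathbf C$; $\boldsymbol\Sigma^0_3$ is the Borel class of countable unions of $G_\delta$ sets. *)

(* Defs.v *)
(* Built on MathComp and MathComp-Analysis; only the Cantor pairing function is
   taken from Stdlib. *)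
From Stdlib Require Import Arith.Cantor.
From mathcomp Require Import all_boot all_order all_algebra.
From mathcomp Require Import all_classical all_reals all_analysis.
From mathcomp Require Import borel_hierarchy.

Set Implicit Arguments.
Unset Strict Implicit.
Unset Printing Implicit Defensive.

Import Order.TTheory GRing.Theory Num.Theory.
Import numFieldNormedType.Exports.

Local Open Scope classical_set_scope.
Local Open Scope ring_scope.

Definition cpair (x y : nat) : nat := Cantor.to_nat (x, y).
Definition cfst (n : nat) : nat := (Cantor.of_nat n).1.
Definition csnd (n : nat) : nat := (Cantor.of_nat n).2.

(* The partial recursive functions, in their unary presentation: tuples of
   arguments are passed through the Cantor pairing function, whose pairing and
   projections are therefore among the basic operations. *)
Inductive rec_code : Type :=
| RZero
| RSucc
| RFst
| RSnd
| RPair of rec_code & rec_code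
| RComp of rec_code & rec_code
| RPrec of rec_code & rec_code
| RMu of rec_code.

(* [rec_eval e x y]: the partial function with code [e] is defined at [x], with
   value [y].  [RComp g f] is g o f, and [RMu f] maps [x] to the least [n] such
   that f <x, n> = 0, all the values f <x, m> with m < n being defined. *)
Inductive rec_eval : rec_code -> nat -> nat -> Prop :=
| eval_zero x : rec_eval RZero x 0
| eval_succ x : rec_eval RSucc x x.+1
| eval_fst x : rec_eval RFst x (cfst x)
| eval_snd x : rec_eval RSnd x (csnd x)
| eval_pair f g x y z :
    rec_eval f x y -> rec_eval g x z -> rec_eval (RPair f g) x (cpair y z)
| eval_comp g f x y z :
    rec_eval f x y -> rec_eval g y z -> rec_eval (RComp g f) x z
| eval_prec0 f g x y :
    rec_eval f x y -> rec_eval (RPrec f g) (cpair x 0) y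
| eval_precS f g x n y z :
    rec_eval (RPrec f g) (cpair x n) y ->
    rec_eval g (cpair x (cpair n y)) z ->
    rec_eval (RPrec f g) (cpair x n.+1) z
| eval_mu f x n (v : nat -> nat) :
    (forall m : nat, (m < n)%N -> rec_eval f (cpair x m) (v m).+1) ->
    rec_eval f (cpair x n) 0 ->
    rec_eval (RMu f) x n.

Definition computable (f : nat -> nat) : Prop :=
  exists e : rec_code, forall x : nat, rec_eval e x (f x).

(* Length-lexicographic bijection between {0,1}^* and nat. *)
Definition string_code (w : seq bool) : nat :=
  foldl (fun (n : nat) (b : bool) => (n.*2 + b.+1)%N) 0%N w.

(* Every rational is (a - b) / (c + 1) for some natural numbers a, b, c. *)
Definition rat_decode (n : nat) : rat :=
  ((cfst (cfst n))%:R - (csnd (cfst n))%:R) / (csnd n).+1%:R.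

Definition computable_rel (P : nat -> nat -> seq bool -> bool) : Prop :=
  exists2 f : nat -> nat, computable f &
    forall (a b : nat) (w : seq bool),
      f (cpair a (cpair b (string_code w))) = nat_of_bool (P a b w).

Definition computable_rat (q : seq bool -> nat -> rat) : Prop :=
  exists2 f : nat -> nat, computable f &
    forall (w : seq bool) (n : nat),
      q w n = rat_decode (f (cpair (string_code w) n)).

Definition computable_real_fun (R : realType) (d : seq bool -> R) : Prop :=
  exists2 q : seq bool -> nat -> rat, computable_rat q &
    forall (w : seq bool) (n : nat), `|d w - ratr (q w n)| <= 2^-1 ^+ n.

Definition restr (A : cantor_space) (n : nat) : seq bool := mkseq A n.

Definition martingale (R : realType) (d : seq bool -> R) : Prop :=
  (forall w : seq bool, 0 <= d w) /\
  (forall w : seq bool, 2 * d w = d (rcons w false) + d (rcons w true)).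

Definition success_set (R : realType) (d : seq bool -> R) : set cantor_space :=
  [set A | limn_esup (fun n : nat => (d (restr A n))%:E) = +oo%E].

Definition RAND_comp (R : realType) : set cantor_space :=
  [set A | forall d : seq bool -> R,
     martingale d -> computable_real_fun d -> ~ success_set d A].

(* Lightface level: as usual for classes of sequences, the innermost number
   quantifier bounds the part of the sequence that the computable matrix reads.
   The length of [restr A c] gives the matrix access to [c] itself. *)
Definition lightface_Pi03 (X : set cantor_space) : Prop :=
  exists2 P : nat -> nat -> seq bool -> bool, computable_rel P &
    X = [set A | forall a : nat, exists b : nat, forall c : nat,
           P a b (restr A c)].

Definition boldface_Sigma03 (X : set cantor_space) : Prop :=
  exists2 G : nat -> set cantor_space, (forall i : nat, Gdelta (G i)) &
    X = \bigcup_i G i.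

(* Main.v *)
Require Import Defs.
From mathcomp Require Import all_boot all_order all_algebra.
From mathcomp Require Import all_classical all_reals all_analysis.
From mathcomp Require Import borel_hierarchy zify ring lra.

(** Upper bound: A is not computably random iff there is a program a such that,
    for every b, at some stage the outputs of a on the arguments below b look
    like approximations of a martingale, and a exceeds b on a prefix of A.  The
    bracket is decidable from a, b and a sufficiently long prefix of A, and if
    it holds for every b then a is total and does approximate a martingale.

    Lower bound: suppose that RAND is the union of the G_delta sets G_i, and let
    d_0, d_1, ... list the computable martingales.  One builds strings
    s_0 < s_1 < ... and martingales D_i, each a finite sum of scaled d_j, such
    that D_i stays below 1 along the limit A from s_i on; so A is random.  In
    the closed set of sequences on which D_i stays below 1, the non-random
    sequences are comeager: on a dense G_delta the sequence follows for
    infinitely many long stretches a computable strategy that keeps D_i from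
    growing, hence is predictable.  As G_i contains only random sequences, some
    open set from its definition misses a cylinder of this closed set, and
    s_(i+1) is chosen in that cylinder to keep A out of G_i. *)

Set Implicit Arguments.
Unset Strict Implicit.
Unset Printing Implicit Defensive.

Import Order.TTheory GRing.Theory Num.Theory.

(** * Closure properties of the computable functions *)

Lemma cfst_pair x y : cfst (cpair x y) = x.
Proof. by rewrite /cfst /cpair Cantor.cancel_of_to. Qed.

Lemma csnd_pair x y : csnd (cpair x y) = y.
Proof. by rewrite /csnd /cpair Cantor.cancel_of_to. Qed.

Lemma cpair_eta n : cpair (cfst n) (csnd n) = n.
Proof. by rewrite /cpair /cfst /csnd -surjective_pairing Cantor.cancel_to_of. Qed.

Definition cpairE := (cfst_pair, csnd_pair, cpair_eta).

Local Opaque cpair cfst csnd.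

Lemma computable_ext f g : f =1 g -> computable f -> computable g.
Proof. by move=> /funext ->. Qed.

Lemma computable_comp g f :
  computable g -> computable f -> computable (fun x => g (f x)).
Proof.
move=> [eg Hg] [ef Hf]; exists (RComp eg ef) => x.
exact: eval_comp (Hf x) (Hg _).
Qed.

Lemma computable_cpair f g :
  computable f -> computable g -> computable (fun x => cpair (f x) (g x)).
Proof.
by move=> [ef Hf] [eg Hg]; exists (RPair ef eg) => x; apply: eval_pair.
Qed.

Lemma computable_cfst f : computable f -> computable (fun x => cfst (f x)).
Proof. by apply: computable_comp; exists RFst => x; constructor. Qed.

Lemma computable_csnd f : computable f -> computable (fun x => csnd (f x)).
Proof. by apply: computable_comp; exists RSnd => x; constructor. Qed.

Lemma computable_succ f : computable f -> computable (fun x => (f x).+1).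
Proof. by apply: computable_comp; exists RSucc => x; constructor. Qed.

Lemma computable_id : computable (fun x => x).
Proof.
apply: (@computable_ext (fun x => cpair (cfst x) (csnd x))).
  by move=> x; rewrite cpairE.
by apply: computable_cpair; [exists RFst | exists RSnd] => x; constructor.
Qed.

Lemma computable_const k : computable (fun=> k).
Proof.
elim: k => [|k]; first by exists RZero => x; constructor.
exact: computable_succ.
Qed.

Lemma computable_iteri N a (h : nat -> nat -> nat -> nat) :
  computable N -> computable a ->
  computable (fun z => h (cfst z) (cfst (csnd z)) (csnd (csnd z))) ->
  computable (fun x => iteri (N x) (h x) (a x)).
Proof.
move=> cN [ea Ha] [eh Hh].
apply: (@computable_ext (fun x => (fun z => iteri (csnd z) (h (cfst z))
   (a (cfst z))) (cpair x (N x)))); first by move=> x; rewrite !cpairE.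
apply: (@computable_comp (fun z => iteri (csnd z) (h (cfst z)) (a (cfst z))));
  last exact: computable_cpair computable_id cN.
exists (RPrec ea eh) => z; rewrite -{1}[z]cpair_eta.
elim: (csnd z) => [|n IH] /=; first exact: eval_prec0.
by apply: eval_precS IH _; have := Hh (cpair (cfst z) (cpair n
  (iteri n (h (cfst z)) (a (cfst z))))); rewrite !cpairE.
Qed.

Lemma computable_iter N a (h : nat -> nat -> nat) :
  computable N -> computable a ->
  computable (fun z => h (cfst z) (csnd (csnd z))) ->
  computable (fun x => iter (N x) (h x) (a x)).
Proof.
move=> cN ca ch.
apply: (@computable_ext (fun x => iteri (N x) (fun _ => h x) (a x))).
  by move=> x; elim: (N x) => //= n ->.
exact: computable_iteri.
Qed.

Lemma computable_if (b : nat -> bool) f g :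
  computable (fun x => nat_of_bool (b x)) -> computable f -> computable g ->
  computable (fun x => if b x then f x else g x).
Proof.
move=> cb cf cg.
apply: (@computable_ext (fun x => iteri (b x) (fun _ _ => f x) (g x))).
  by move=> x; case: (b x).
apply: (@computable_iteri _ _ (fun x _ _ => f x)) => //.
exact: computable_comp cf (computable_cfst computable_id).
Qed.

Lemma computable_predn f : computable f -> computable (fun x => (f x).-1).
Proof.
move=> cf; apply: (@computable_ext (fun x => iteri (f x) (fun k _ => k) 0)).
  by move=> x; case: (f x).
apply: (@computable_iteri _ _ (fun _ k _ => k)) => //.
  exact: computable_const.
exact/computable_cfst/computable_csnd/computable_id.
Qed.

Lemma computable_addn f g :
  computable f -> computable g -> computable (fun x => f x + g x).
Proof.
move=> cf cg; apply: (@computable_ext (fun x => iter (f x) succn (g x))).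
  by move=> x; rewrite iter_succn addnC.
apply: (@computable_iter _ _ (fun _ => succn)) => //.
exact/computable_succ/computable_csnd/computable_csnd/computable_id.
Qed.

Lemma computable_subn f g :
  computable f -> computable g -> computable (fun x => f x - g x).
Proof.
move=> cf cg; apply: (@computable_ext (fun x => iter (g x) predn (f x))).
  by move=> x; rewrite iter_predn.
apply: (@computable_iter _ _ (fun _ => predn)) => //.
exact/computable_predn/computable_csnd/computable_csnd/computable_id.
Qed.

Lemma computable_muln f g :
  computable f -> computable g -> computable (fun x => f x * g x).
Proof.
move=> cf cg; apply: (@computable_ext (fun x => iter (g x) (addn (f x)) 0)).
  by move=> x; rewrite iter_addn addn0.
apply: (@computable_iter _ _ (fun x => addn (f x))) => //.
  exact: computable_const.
apply: computable_addn; last exact/computable_csnd/computable_csnd/computable_id.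
exact: computable_comp cf (computable_cfst computable_id).
Qed.

Lemma computable_expn f g :
  computable f -> computable g -> computable (fun x => f x ^ g x).
Proof.
move=> cf cg; apply: (@computable_ext (fun x => iter (g x) (muln (f x)) 1)).
  by move=> x; rewrite iter_muln muln1.
apply: (@computable_iter _ _ (fun x => muln (f x))) => //.
  exact: computable_const.
apply: computable_muln; last exact/computable_csnd/computable_csnd/computable_id.
exact: computable_comp cf (computable_cfst computable_id).
Qed.

Lemma computable_double f : computable f -> computable (fun x => (f x).*2).
Proof.
move=> cf; apply: (@computable_ext (fun x => f x + f x)).
  by move=> x; rewrite addnn.
exact: computable_addn.
Qed.

Lemma computable_eq0 f :
  computable f -> computable (fun x => nat_of_bool (f x == 0)).
Proof.
move=> cf; apply: (@computable_ext (fun x => 1 - f x)).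
  by move=> x; case: (f x).
exact: computable_subn (computable_const 1) cf.
Qed.

Lemma computable_leq f g : computable f -> computable g ->
  computable (fun x => nat_of_bool (f x <= g x)).
Proof. by move=> cf cg; apply/computable_eq0/computable_subn. Qed.

Lemma computable_andb (b c : nat -> bool) :
  computable (fun x => nat_of_bool (b x)) ->
  computable (fun x => nat_of_bool (c x)) ->
  computable (fun x => nat_of_bool (b x && c x)).
Proof.
move=> cb cc; apply: (@computable_ext (fun x => b x * c x)).
  by move=> x; rewrite mulnb.
exact: computable_muln.
Qed.

Lemma computable_negb (b : nat -> bool) :
  computable (fun x => nat_of_bool (b x)) ->
  computable (fun x => nat_of_bool (~~ b x)).
Proof.
move=> cb; apply: (@computable_ext (fun x => nat_of_bool (nat_of_bool (b x) == 0))).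
  by move=> x; case: (b x).
exact: computable_eq0.
Qed.

Lemma computable_eqn f g : computable f -> computable g ->
  computable (fun x => nat_of_bool (f x == g x)).
Proof.
move=> cf cg.
apply: (@computable_ext (fun x => nat_of_bool ((f x <= g x) && (g x <= f x)))).
  by move=> x; rewrite -eqn_leq.
by apply: computable_andb; apply: computable_leq.
Qed.

Lemma computable_odd f :
  computable f -> computable (fun x => nat_of_bool (odd (f x))).
Proof.
move=> cf; apply: (@computable_ext (fun x => iter (f x) (fun r => 1 - r) 0)).
  by move=> x; elim: (f x) => //= n ->; case: odd.
apply: (@computable_iter _ _ (fun _ r => 1 - r)) => //.
  exact: computable_const.
apply: computable_subn (computable_const 1) _.
exact/computable_csnd/computable_csnd/computable_id.
Qed.

Lemma computable_half f : computable f -> computable (fun x => (f x)./2).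
Proof.
move=> cf.
apply: (@computable_ext (fun x => iteri (f x) (fun k r => odd k + r) 0)).
  by move=> x; elim: (f x) => //= n ->; rewrite uphalf_half.
apply: (@computable_iteri _ _ (fun _ k r => odd k + r)) => //.
  exact: computable_const.
apply: computable_addn; last exact/computable_csnd/computable_csnd/computable_id.
exact/computable_odd/computable_cfst/computable_csnd/computable_id.
Qed.

Definition ball n (p : nat -> bool) : bool := all p (iota 0 n).

Lemma ballP n (p : nat -> bool) :
  reflect (forall i, i < n -> p i) (ball n p).
Proof.
apply: (iffP allP) => H i; last by rewrite mem_iota add0n; apply: H.
by move=> Hi; apply: H; rewrite mem_iota.
Qed.

Lemma computable_ball N (p : nat -> nat -> bool) : computable N ->
  computable (fun z => nat_of_bool (p (cfst z) (csnd z))) ->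
  computable (fun x => nat_of_bool (ball (N x) (p x))).
Proof.
move=> cN cp.
apply: (@computable_ext (fun x => iteri (N x) (fun k r => r * p x k) 1)).
  move=> x; rewrite /ball; elim: (N x) => // n IH.
  by rewrite -[in RHS]addn1 iotaD all_cat /= IH add0n andbT mulnb.
apply: (@computable_iteri _ _ (fun x k r => r * p x k)) => //.
  exact: computable_const.
apply: computable_muln; first exact/computable_csnd/computable_csnd/computable_id.
apply: (@computable_ext (fun z => (fun y => nat_of_bool (p (cfst y) (csnd y)))
  (cpair (cfst z) (cfst (csnd z))))); first by move=> z; rewrite !cpairE.
apply: computable_comp cp _; apply: computable_cpair.
  exact/computable_cfst/computable_id.
exact/computable_cfst/computable_csnd/computable_id.
Qed.

Lemma computable_mu (p : nat -> nat -> bool) (H : forall x, exists n, p x n) :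
  computable (fun z => nat_of_bool (p (cfst z) (csnd z))) ->
  computable (fun x => ex_minn (H x)).
Proof.
(* [RMu] searches for a zero, hence the negation; all earlier values are then 1. *)
move=> cp; have [e He] := computable_negb cp; exists (RMu e) => x.
case: ex_minnP => n pn nmin; apply: (@eval_mu _ _ _ (fun=> 0)) => [m mn|].
  have := He (cpair x m); rewrite !cpairE.
  by case pm: (p x m) => //; have := nmin _ pm; rewrite leqNgt mn.
by have := He (cpair x n); rewrite !cpairE pn.
Qed.

(** In the length-lexicographic numbering the strings form a binary heap: [n] has children [2n+1]
    and [2n+2], so this map deletes the last bit. It fixes 0, the code of the empty string. *)
Definition parent n := n.-1./2.

Lemma computable_parent f : computable f -> computable (fun x => parent (f x)).
Proof. by move=> cf; apply/computable_half/computable_predn. Qed.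

(** Syntax-directed on the head symbol; the last case eta-expands a bare function so that another
    case can apply. *)
Ltac comp_step := cbv beta; lazymatch goal with
  | |- computable (fun x => x) => exact: computable_id
  | |- computable (fun _ => ?c) => exact: computable_const
  | H : computable ?f |- computable ?f => exact: H
  | |- computable (fun x => parent _) => apply: computable_parent
  | |- computable (fun x => cpair _ _) => apply: computable_cpair
  | |- computable (fun x => cfst _) => apply: computable_cfst
  | |- computable (fun x => csnd _) => apply: computable_csnd
  | |- computable (fun x => S _) => apply: computable_succ
  | |- computable (fun x => predn _) => apply: computable_predn
  | |- computable (fun x => addn _ _) => apply: computable_addn
  | |- computable (fun x => subn _ _) => apply: computable_subn
  | |- computable (fun x => muln _ _) => apply: computable_muln
  | |- computable (fun x => expn _ _) => apply: computable_expn
  | |- computable (fun x => double _) => apply: computable_double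
  | |- computable (fun x => half _) => apply: computable_half
  | |- computable (fun x => if _ then _ else _) => apply: computable_if
  | |- computable (fun x => iteri (@?N x) (@?h x) (@?a x)) =>
      apply: (@computable_iteri N a h)
  | |- computable (fun x => iter (@?N x) (@?h x) (@?a x)) =>
      apply: (@computable_iter N a h)
  | |- computable (fun x => nat_of_bool (leq _ _)) => apply: computable_leq
  | |- computable (fun x => nat_of_bool (andb _ _)) => apply: computable_andb
  | |- computable (fun x => nat_of_bool (negb _)) => apply: computable_negb
  | |- computable (fun x => nat_of_bool (odd _)) => apply: computable_odd
  | |- computable (fun x => nat_of_bool (ball (@?N x) (@?p x))) =>
      apply: (@computable_ball N p)
  | |- computable (fun x => nat_of_bool (eq_op _ _)) => apply: computable_eqn
  | |- computable ?f => lazymatch f with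
      | fun _ => _ => fail
      | _ => change (computable (fun x => f x))
      end
  end.
Ltac comp := repeat comp_step.

(** * Computing on strings through their codes *)

Lemma string_code_rcons w b :
  string_code (rcons w b) = (string_code w).*2 + b.+1.
Proof. by rewrite /string_code foldl_rcons. Qed.

Lemma parent_rcons w b : parent (string_code (rcons w b)) = string_code w.
Proof.
rewrite string_code_rcons /parent addnS /=.
by case: b; rewrite ?addn0 ?addn1 /= ?uphalf_double ?doubleK.
Qed.

Lemma odd_string_code w b : odd (string_code (rcons w b)).-1 = b.
Proof. by rewrite string_code_rcons addnS /= oddD odd_double; case: b. Qed.

Lemma iter_parent w j :
  iter j parent (string_code w) = string_code (take (size w - j) w).
Proof.
elim: j w => [|j IH] w; first by rewrite subn0 take_size.
rewrite iterSr; case/lastP: w => [|w b]; first by rewrite (IH [::]) .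
rewrite parent_rcons IH size_rcons subSS -cats1 take_cat.
by case: ltnP => // le; rewrite (_ : size w - j = size w) ?subnn ?cats0 ?take_size //; lia.
Qed.

Lemma size_string_code w : size w <= string_code w.
Proof.
elim/last_ind: w => // w b; rewrite size_rcons string_code_rcons -addnn; lia.
Qed.

Lemma string_code_eq0 w : (string_code w == 0) = (w == [::]).
Proof.
case/lastP: w => // w b; rewrite string_code_rcons addnS.
by case: w.
Qed.

(** A code gives access to its prefixes from the longest down, whereas [F] is built from the
    shortest up; so each round of a primitive recursion recomputes the prefix it needs. *)
Lemma computable_string_rec (F : seq bool -> nat) (h : nat -> nat -> nat -> nat) :
  computable (fun z => h (cfst z) (cfst (csnd z)) (csnd (csnd z))) ->
  (forall w (b : bool), F (rcons w b) = h (string_code w) b (F w)) ->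
  exists2 f, computable f & forall w, f (string_code w) = F w.
Proof.
move=> ch Fh.
(* As [i] grows these are codes of longer and longer prefixes. There may be more rounds than bits;
   the surplus ones come first, see the empty prefix and reset the value to [F [::]]. *)
pose m n i := iter (n - i.+1) parent n.
have cm : computable (fun z => m (cfst z) (cfst (csnd z))).
  by rewrite /m; comp.
exists (fun n => iteri n (fun i r => if m n i == 0 then F [::]
   else h (parent (m n i)) (odd (m n i).-1) r) (F [::])).
  comp.
  apply: (@computable_ext (fun z => (fun y => h (cfst y) (cfst (csnd y)) (csnd (csnd y)))
    (cpair (parent (m (cfst z) (cfst (csnd z)))) (cpair
      (odd (m (cfst z) (cfst (csnd z))).-1) (csnd (csnd z)))))).
    by move=> z; rewrite !cpairE.
  apply: computable_comp ch _; comp.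
move=> w; set n := string_code w.
have nw : size w <= n by exact: size_string_code.
suff H k : k <= n -> iteri k (fun i r => if m n i == 0 then F [::]
   else h (parent (m n i)) (odd (m n i).-1) r) (F [::])
   = F (take (size w - (n - k)) w) by rewrite H // subnn subn0 take_size.
elim: k => [_|k IH kn] /=.
  by rewrite subn0 (_ : _ - _ = 0) ?take0 //; lia.
rewrite IH 1?ltnW // /m /n iter_parent -/n string_code_eq0.
case: (posnP (size w - (n - k.+1))) => [->|pos].
  by rewrite take0.
have lt : size w - (n - k) < size w by lia.
have -> : size w - (n - k.+1) = (size w - (n - k)).+1 by lia.
rewrite (take_nth false) //.
have -> : (rcons (take (size w - (n - k)) w) (nth false w (size w - (n - k))) == [::]) = false.
  by case: (take _ _).
by rewrite parent_rcons odd_string_code Fh.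
Qed.

(** * A stepwise universal evaluator *)

Fixpoint code_nat (e : rec_code) : nat :=
  match e with
  | RZero => cpair 0 0
  | RSucc => cpair 1 0
  | RFst => cpair 2 0
  | RSnd => cpair 3 0
  | RPair f g => cpair 4 (cpair (code_nat f) (code_nat g))
  | RComp g f => cpair 5 (cpair (code_nat g) (code_nat f))
  | RPrec f g => cpair 6 (cpair (code_nat f) (code_nat g))
  | RMu f => cpair 7 (code_nat f)
  end.

(* A stack is 0 when empty; a machine state is [cpair v K], with current value
   [v] and stack of pending instructions [K]. *)
Definition push (i K : nat) : nat := (cpair i K).+1.

(* Tags 0-7 are the constructors of [rec_code]; tags 8-11 are continuations,
   which carry the data saved while a component is evaluated:
   8: evaluate the second component of a pair, 9: apply the step function of a
   primitive recursion, 10: test a value during a search, 11: form a pair. *)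
Definition exec (v i K : nat) : nat :=
  if cfst i == 0 then cpair 0 K
  else if cfst i == 1 then cpair v.+1 K
  else if cfst i == 2 then cpair (cfst v) K
  else if cfst i == 3 then cpair (csnd v) K
  else if cfst i == 4 then
    cpair v (push (cfst (csnd i)) (push (cpair 8 (cpair (csnd (csnd i)) v)) K))
  else if cfst i == 5 then
    cpair v (push (csnd (csnd i)) (push (cfst (csnd i)) K))
  else if cfst i == 6 then
    if csnd v == 0 then cpair (cfst v) (push (cfst (csnd i)) K)
    else cpair (cpair (cfst v) (csnd v).-1) (push i
      (push (cpair 9 (cpair (csnd (csnd i)) (cpair (cfst v) (csnd v).-1))) K))
  else if cfst i == 7 then
    cpair (cpair v 0)
      (push (csnd i) (push (cpair 10 (cpair (csnd i) (cpair v 0))) K))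
  else if cfst i == 8 then
    cpair (csnd (csnd i)) (push (cfst (csnd i)) (push (cpair 11 v) K))
  else if cfst i == 9 then
    cpair (cpair (cfst (csnd (csnd i))) (cpair (csnd (csnd (csnd i))) v))
      (push (cfst (csnd i)) K)
  else if cfst i == 10 then
    if v == 0 then cpair (csnd (csnd (csnd i))) K
    else cpair (cpair (cfst (csnd (csnd i))) (csnd (csnd (csnd i))).+1)
      (push (cfst (csnd i)) (push (cpair 10 (cpair (cfst (csnd i))
        (cpair (cfst (csnd (csnd i))) (csnd (csnd (csnd i))).+1))) K))
  else cpair (cpair (csnd i) v) K.

Definition step (s : nat) : nat :=
  if csnd s == 0 then s
  else exec (cfst s) (cfst (csnd s).-1) (csnd (csnd s).-1).

Lemma computable_step f : computable f -> computable (fun x => step (f x)).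
Proof. by apply: computable_comp; rewrite /step /exec /push; comp. Qed.

Local Lemma eqS0F n : (n.+1 == 0) = false. Proof. by []. Qed.

Lemma step_push v i K : step (cpair v (push i K)) = exec v i K.
Proof.
by rewrite /step csnd_pair cfst_pair /push succnK eqS0F csnd_pair cfst_pair.
Qed.

Definition reaches (s t : nat) : Prop := exists k, iter k step s = t.

Lemma reaches_refl s : reaches s s.
Proof. by exists 0. Qed.

Lemma reaches_trans t s u : reaches s t -> reaches t u -> reaches s u.
Proof. by move=> [k <-] [l <-]; exists (l + k); rewrite iterD. Qed.

Lemma reaches_step v i K t :
  reaches (exec v i K) t -> reaches (cpair v (push i K)) t.
Proof. by apply: reaches_trans; exists 1; rewrite /= step_push. Qed.

(** The arbitrary remaining stack [K] lets the induction hypotheses be chained: each component runs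
    on top of the continuation left by the previous one. *)
Lemma rec_eval_reaches e x y : rec_eval e x y ->
  forall K, reaches (cpair x (push (code_nat e) K)) (cpair y K).
Proof.
elim => {e x y} /=
  [x|x|x|x|f g x y z _ IHf _ IHg|g f x y z _ IHf _ IHg|f g x y _ IHf
  |f g x n y z _ IH _ IHg|f x n v _ IHpos _ IH0] K.
- by apply: reaches_step; rewrite /exec !cpairE; apply: reaches_refl.
- by apply: reaches_step; rewrite /exec !cpairE; apply: reaches_refl.
- by apply: reaches_step; rewrite /exec !cpairE; apply: reaches_refl.
- by apply: reaches_step; rewrite /exec !cpairE; apply: reaches_refl.
- apply: reaches_step; rewrite /exec !cpairE /=; apply: reaches_trans (IHf _) _.
  apply: reaches_step; rewrite /exec !cpairE /=; apply: reaches_trans (IHg _) _.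
  by apply: reaches_step; rewrite /exec !cpairE /=; apply: reaches_refl.
- apply: reaches_step; rewrite /exec !cpairE /=; apply: reaches_trans (IHf _) _.
  exact: IHg.
- by apply: reaches_step; rewrite /exec !cpairE /=; apply: IHf.
- apply: reaches_step; rewrite /exec !cpairE /=; apply: reaches_trans (IH _) _.
  by apply: reaches_step; rewrite /exec !cpairE /=; apply: IHg.
- apply: reaches_step; rewrite /exec !cpairE /=.
  (* [S m] is the search about to evaluate [f] at [<x, m>]: a nonzero value leads to [S m.+1], a
     zero pops the test and returns [m]. *)
  pose S m := cpair (cpair x m) (push (code_nat f)
    (push (cpair 10 (cpair (code_nat f) (cpair x m))) K)).
  suff H m : m <= n -> reaches (S 0) (S m).
    apply: reaches_trans (H n (leqnn n)) _; apply: reaches_trans (IH0 _) _.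
    by apply: reaches_step; rewrite /exec !cpairE /=; apply: reaches_refl.
  elim: m => [|m IHm] mn; first exact: reaches_refl.
  apply: reaches_trans (IHm (ltnW mn)) _; apply: reaches_trans (IHpos _ mn _) _.
  by apply: reaches_step; rewrite /exec !cpairE /=; apply: reaches_refl.
Qed.

Definition run (a z s : nat) : nat := iter s step (cpair z (push a 0)).
Definition halted (a z s : nat) : bool := csnd (run a z s) == 0.
Definition out (a z s : nat) : nat := cfst (run a z s).

Lemma computable_run a z s : computable a -> computable z -> computable s ->
  computable (fun x => run (a x) (z x) (s x)).
Proof.
move=> ca cz cs; rewrite /run /push; apply: (@computable_iter _ _ (fun=> step)).
- by comp.
- by comp.
- by apply: computable_step; comp.
Qed.

Lemma run_halted a z s t : halted a z s -> s <= t -> run a z t = run a z s.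
Proof.
move=> h /subnK <-; rewrite /run iterD -/(run a z s).
by elim: (t - s) => //= k ->; rewrite /step; move: h; rewrite /halted => ->.
Qed.

Lemma halted_le a z s t : halted a z s -> s <= t -> halted a z t.
Proof. by move=> h st; rewrite /halted (run_halted h st). Qed.

Lemma out_halted a z s t : halted a z s -> halted a z t -> out a z s = out a z t.
Proof.
by move=> hs ht; rewrite /out; case: (leqP s t) => [/(run_halted hs)|/ltnW /(run_halted ht)] ->.
Qed.

Definition computes (a : nat) (f : nat -> nat) : Prop :=
  forall z, exists s, halted a z s /\ out a z s = f z.

Lemma computable_computes f : computable f -> exists a, computes a f.
Proof.
move=> [e He]; exists (code_nat e) => z.
have [s Hs] := rec_eval_reaches (He z) 0.
by exists s; rewrite /halted /out /run Hs !cpairE.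
Qed.

(* No decoding is needed: a number [a] which codes no program still denotes a
   partial computable function, the one its machine computes. *)
Lemma computes_computable a f : computes a f -> computable f.
Proof.
move=> H; have Hh z : exists s, halted a z s by have [s []] := H z; exists s.
apply: (@computable_ext (fun z => cfst (run a z (ex_minn (Hh z))))).
  move=> z; case: ex_minnP => s hs _; have [t [ht <-]] := H z.
  exact: out_halted.
apply/computable_cfst/computable_run; [by comp|by comp|].
by apply: computable_mu; rewrite /halted; apply: computable_eqn;
  [apply: computable_csnd; apply: computable_run|]; comp.
Qed.

Lemma halted_total a : (forall z, exists s, halted a z s) ->
  exists2 f, computes a f & computable f.
Proof.
move=> H; exists (fun z => out a z (ex_minn (H z))) => [z|].
  by case: ex_minnP => s hs _; exists s.
apply: (@computes_computable a) => z; by case: ex_minnP => s hs _; exists s.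
Qed.

(** * Arithmetic of rational codes *)

(** Fractions are never reduced, and numerators stay formal differences. The final predecessor
    offsets the successor that [rat_decode] applies to the denominator. *)
Definition radd (x y : nat) : nat :=
  cpair (cpair (cfst (cfst x) * (csnd y).+1 + cfst (cfst y) * (csnd x).+1)
               (csnd (cfst x) * (csnd y).+1 + csnd (cfst y) * (csnd x).+1))
        ((csnd x).+1 * (csnd y).+1).-1.

Definition rdiv2n (x k : nat) : nat :=
  cpair (cfst x) ((csnd x).+1 * 2 ^ k).-1.

Definition rnat (j : nat) : nat := cpair (cpair j 0) 0.

(** Cross-multiplication, with the subtracted parts moved to the opposite side so as to remain in
    the natural numbers. *)
Definition rle (x y : nat) : bool :=
  cfst (cfst x) * (csnd y).+1 + csnd (cfst y) * (csnd x).+1 <=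
  cfst (cfst y) * (csnd x).+1 + csnd (cfst x) * (csnd y).+1.

Lemma computable_radd f g :
  computable f -> computable g -> computable (fun x => radd (f x) (g x)).
Proof. by move=> cf cg; rewrite /radd; comp. Qed.

Lemma computable_rdiv2n f g :
  computable f -> computable g -> computable (fun x => rdiv2n (f x) (g x)).
Proof. by move=> cf cg; rewrite /rdiv2n; comp. Qed.

Lemma computable_rnat f : computable f -> computable (fun x => rnat (f x)).
Proof. by move=> cf; rewrite /rnat; comp. Qed.

Lemma computable_rle f g : computable f -> computable g ->
  computable (fun x => nat_of_bool (rle (f x) (g x))).
Proof. by move=> cf cg; rewrite /rle; comp. Qed.

Section RatCode.
Local Open Scope ring_scope.

Lemma radd_decode x y : rat_decode (radd x y) = rat_decode x + rat_decode y.
Proof.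
rewrite /rat_decode /radd !cfst_pair !csnd_pair.
rewrite prednK ?muln_gt0 // !natrD !natrM.
have nz n : n.+1%:R != 0 :> rat by rewrite pnatr_eq0.
have := nz (csnd x); have := nz (csnd y).
move: (csnd x).+1%:R (csnd y).+1%:R => c c' c'0 c0; field.
by rewrite c0 c'0.
Qed.

Lemma rdiv2n_decode x k : rat_decode (rdiv2n x k) = rat_decode x * 2^-1 ^+ k.
Proof.
rewrite /rat_decode /rdiv2n !cfst_pair !csnd_pair.
by rewrite prednK ?muln_gt0 ?expn_gt0 // natrM natrX invfM exprVn mulrA.
Qed.

Lemma rnat_decode j : rat_decode (rnat j) = j%:R.
Proof. by rewrite /rat_decode /rnat !cfst_pair !csnd_pair subr0 divr1. Qed.

Lemma rleE x y : rle x y = (rat_decode x <= rat_decode y).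
Proof.
rewrite /rat_decode /rle.
have p n : 0 < n.+1%:R :> rat by rewrite ltr0n.
rewrite ler_pdivrMr // mulrAC ler_pdivlMr //.
rewrite -(ler_nat rat) !natrD !natrM.
by apply/idP/idP; lra.
Qed.

End RatCode.

(** * Real values of rational codes *)

Definition decoded (R : realType) (n : nat) : R := ratr (rat_decode n).

Section Decoded.
Local Open Scope ring_scope.
Variable R : realType.
Local Notation decoded := (@decoded R).

Lemma radd_decoded x y : decoded (radd x y) = decoded x + decoded y.
Proof. by rewrite /decoded radd_decode rmorphD. Qed.

Lemma rdiv2n_decoded x k : decoded (rdiv2n x k) = decoded x * 2^-1 ^+ k.
Proof.
have half : ratr (2^-1 : rat) = 2^-1 :> R.
  by rewrite fmorphV; congr (_^-1); exact: (ratr_nat R 2).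
by rewrite /decoded rdiv2n_decode rmorphM /= rmorphXn /= half.
Qed.

Lemma rnat_decoded j : decoded (rnat j) = j%:R.
Proof. by rewrite /decoded rnat_decode ratr_nat. Qed.

Lemma rle_decoded x y : rle x y = (decoded x <= decoded y).
Proof. by rewrite /decoded ler_rat rleE. Qed.

Lemma pow_half_small (e : R) : 0 < e -> exists n, 2^-1 ^+ n < e.
Proof.
move=> e0; have e1 : 0 < e^-1 by rewrite invr_gt0.
exists (Num.truncn e^-1).+1; rewrite exprVn invf_plt ?posrE ?exprn_gt0 //.
apply: lt_trans (truncnS_gt _) _; rewrite -natrX ltr_nat.
exact: ltn_expl.
Qed.

Lemma squeeze_pow_half (x c : R) : (forall n, `|x| <= c * 2^-1 ^+ n) -> x = 0.
Proof.
move=> H; apply/eqP; rewrite -normr_eq0 eq_le normr_ge0 andbT leNgt.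
apply/negP => x0.
have c0 : 0 < c.
  have := lt_le_trans x0 (H 0%N); rewrite expr0 mulr1 //.
have [n] := pow_half_small (divr_gt0 x0 c0); rewrite ltr_pdivlMr // mulrC.
by rewrite ltNge H.
Qed.

(** Finitely many real terms are always bounded, so an unbounded sequence is unbounded on every
    tail. This removes the limit superior from the rest of the argument. *)
Lemma limn_esup_unbounded (u : nat -> R) :
  limn_esup (fun n => (u n)%:E) = +oo%E <-> forall N : nat, exists n, N%:R <= u n.
Proof.
have -> : limn_esup (fun n => (u n)%:E) =
    ereal_inf (range (esups (fun n => (u n)%:E))).
  by rewrite limn_esup_lim; apply/cvg_lim => //; exact: cvg_esups_inf.
split=> [inf_oo N|unb].
  have : (N%:R%:E < esups (fun n => (u n)%:E) 0%N)%E.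
    apply: (@lt_le_trans _ _ +oo%E); first exact: ltry.
    by rewrite -inf_oo; apply: ereal_inf_lbound; exists 0%N.
  move=> /ereal_sup_gt [_ [n _ <-]]; rewrite lte_fin => /ltW lt.
  by exists n.
apply/eqP; rewrite -leye_eq; apply: le_ereal_inf_tmp => _ [n _ <-].
rewrite leye_eq; apply/eqP/eq_infty => r.
(* [s] dominates the first [n] terms, so a term exceeding it has index at least [n]. *)
pose s := \sum_(i < n) `|u i|.
have [k] := unb (Num.truncn (Num.max r s)).+1.
move=> /(lt_le_trans (truncnS_gt _)); rewrite gt_max => /andP[rk sk].
apply: le_trans (_ : ((u k)%:E <= _)%E); first by rewrite lee_fin ltW.
apply: ereal_sup_ubound; exists k => //=; rewrite leqNgt; apply/negP => kn.
move: sk; rewrite ltNge /s (bigD1 (Ordinal kn)) //=.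
by rewrite (le_trans (ler_norm _)) // lerDl sumr_ge0.
Qed.

End Decoded.

Lemma size_restr A n : size (restr A n) = n.
Proof. exact: size_mkseq. Qed.

Lemma take_restr A m n : m <= n -> take m (restr A n) = restr A m.
Proof. by move=> mn; rewrite /restr /mkseq -map_take take_iota (minn_idPl mn). Qed.

Lemma string_code_surj n : exists w, string_code w = n.
Proof.
elim/ltn_ind: n => -[|n] IH; first by exists [::].
have [|w Hw] := IH n./2; first by lia.
exists (rcons w (odd n)); rewrite string_code_rcons Hw -[in RHS](odd_double_half n).
by rewrite addnS addnC.
Qed.

Lemma not_RAND_comp (R : realType) A : ~ RAND_comp R A <->
  exists d : seq bool -> R, [/\ martingale d, computable_real_fun d &
    forall N : nat, exists n, (N%:R <= d (restr A n))%R].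
Proof.
split=> [|[d [md cd unb]] rA]; last first.
  by apply: (rA d md cd); apply/limn_esup_unbounded.
move/existsNP => [d] /not_implyP[md] /not_implyP[cd] /contrapT s.
by exists d; split => //; apply/limn_esup_unbounded.
Qed.

(** * The upper bound *)

(* For total [V], the condition "[check V z] for all z" says exactly that
   [V (cpair (string_code w) k)] codes a 2^-k-approximation of [d w], for some
   martingale d. *)
Definition check (V : nat -> nat) (z : nat) : bool :=
  let u := cfst z in let k := cfst (csnd z) in let m := csnd (csnd z) in
  let v := V (cpair u k) in
  let v01 := radd (V (cpair u.*2.+1 k)) (V (cpair u.*2.+2 k)) in
  [&& rle v (radd (V (cpair u m)) (radd (rdiv2n (rnat 1) k) (rdiv2n (rnat 1) m))),
      rle (rnat 0) (radd v (rdiv2n (rnat 1) k)),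
      rle (radd v v) (radd v01 (rdiv2n (rnat 4) k))
    & rle v01 (radd (radd v v) (rdiv2n (rnat 4) k))].

(** These are exactly the arguments at which [check] queries [V]; [u.*2.+1] and [u.*2.+2] code the
    two one-bit extensions of the string coded by [u]. *)
Definition halted_check (a z s : nat) : bool :=
  let u := cfst z in let k := cfst (csnd z) in let m := csnd (csnd z) in
  [&& halted a (cpair u k) s, halted a (cpair u m) s,
      halted a (cpair u.*2.+1 k) s & halted a (cpair u.*2.+2 k) s].

Definition large (a b u s : nat) : bool :=
  halted a (cpair u 0) s && rle (rnat b) (out a (cpair u 0) s).

(* With s = string_code (A|c): up to stage s, program [a] looks like a
   martingale on the arguments below b, and exceeds b on a prefix of A|c. *)
Definition exceeds (a b s : nat) : bool :=
  ball b (fun z => halted_check a z s && check (fun y => out a y s) z) &&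
  ~~ ball s.+1 (fun i => ~~ large a b (iter i parent s) s).

Lemma computable_exceeds : computable (fun x =>
  nat_of_bool (exceeds (cfst x) (cfst (csnd x)) (csnd (csnd x)))).
Proof.
rewrite /exceeds /halted_check /check /large /halted /out; cbv zeta.
repeat (first [comp_step | cbv beta; lazymatch goal with
  | |- computable (fun x => run _ _ _) => apply: computable_run
  | |- computable (fun x => radd _ _) => apply: computable_radd
  | |- computable (fun x => rdiv2n _ _) => apply: computable_rdiv2n
  | |- computable (fun x => rnat _) => apply: computable_rnat
  | |- computable (fun x => nat_of_bool (rle _ _)) => apply: computable_rle
  end]).
Qed.

Lemma exceedsP a b w : reflect
  ((forall z, z < b -> halted_check a z (string_code w) &&
      check (fun y => out a y (string_code w)) z) /\
   exists2 n, n <= size w & large a b (string_code (take n w)) (string_code w))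
  (exceeds a b (string_code w)).
Proof.
apply: (iffP andP) => -[/ballP Hc H]; split=> //.
  have [i [iw Hi]] : exists i, i < (string_code w).+1 /\
      large a b (iter i parent (string_code w)) (string_code w).
    apply: contrapT => /forallNP no; move/negP: H; apply; apply/ballP => i Hi.
    by apply/negP => l; apply: (no i).
  (* If [i] exceeds [size w], truncated subtraction and [parent] both stop at the empty string. *)
  by exists (size w - i); rewrite ?leq_subr // -iter_parent.
apply/negP => /ballP no; have [n nw l] := H.
have := no (size w - n); rewrite ltnS iter_parent subKn // l.
have := size_string_code w => sw.
by move=> /(_ (leq_trans (leq_subr _ _) sw)).
Qed.

Lemma check_ext a z s f : computes a f -> halted_check a z s ->
  check (fun y => out a y s) z = check f z.
Proof.
move=> af /and4P[h1 h2 h3 h4]; rewrite /check.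
have outE y : halted a y s -> out a y s = f y.
  by move=> h; have [t [ht <-]] := af y; apply: out_halted.
by rewrite !outE.
Qed.

Lemma large_ext a b u s f : computes a f -> large a b u s ->
  rle (rnat b) (f (cpair u 0)).
Proof.
move=> af /andP[h]; have [t [ht <-]] := af (cpair u 0).
by rewrite (out_halted h ht).
Qed.

Lemma uniform_bound (P : nat -> nat -> Prop) b :
  (forall z, exists s, forall t, s <= t -> P z t) ->
  exists s, forall z, z < b -> forall t, s <= t -> P z t.
Proof.
move=> H; elim: b => [|b [s IH]]; first by exists 0.
have [s' Hs'] := H b; exists (maxn s s') => z; rewrite ltnS leq_eqVlt.
move=> /orP[/eqP->|zb] t; rewrite geq_max => /andP[st s't]; first exact: Hs'.
exact: IH.
Qed.

(** Precision 0 suffices: an error of at most 1 does not affect unboundedness. *)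
Definition unbounded_along (f : nat -> nat) (A : cantor_space) : Prop :=
  forall b, exists n, rle (rnat b) (f (cpair (string_code (restr A n)) 0)).

(** The code of a prefix of [A] serves both as the part of [A] that is read and as the time bound
    for the program. It is at least the length of the prefix, so long prefixes allow any running
    time. *)
Lemma exceeds_program (A : cantor_space) :
  (exists a, forall b, exists c, exceeds a b (string_code (restr A c))) <->
  exists f, [/\ computable f, forall z, check f z & unbounded_along f A].
Proof.
split=> [[a H]|[f [/computable_computes[a af] fc fu]]].
  have tot z : exists s, halted a z s.
    (* Chosen so that the first query made in checking [z'] is [z] itself. *)
    pose z' := cpair (cfst z) (cpair (csnd z) (csnd z)).
    have [c /exceedsP[/(_ z' (ltnSn _)) /andP[/and4P[h _ _ _] _] _]] := H z'.+1.
    by move: h; rewrite /z' !cpairE; exists (string_code (restr A c)).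
  have [f af cf] := halted_total tot; exists f; split=> // [z|b].
    have [c /exceedsP[/(_ z (ltnSn _)) /andP[h]]] := H z.+1.
    by rewrite (check_ext af h).
  have [c /exceedsP[_ [n nc /(large_ext af)]]] := H b.
  by rewrite size_restr in nc; rewrite (take_restr _ nc) => h; exists n.
exists a => b; have [n rn] := fu b.
pose stable z s := halted a z s /\ out a z s = f z.
have st z : exists s, forall t, s <= t -> stable z t.
  have [s [hs es]] := af z; exists s => t le.
  have ht := halted_le hs le; split => //.
  by rewrite -(out_halted hs ht).
have stc z : exists s, forall t, s <= t -> halted_check a z t.
  pose u := cfst z; pose k := cfst (csnd z); pose m := csnd (csnd z).
  have [s1 H1] := st (cpair u k); have [s2 H2] := st (cpair u m).
  have [s3 H3] := st (cpair u.*2.+1 k); have [s4 H4] := st (cpair u.*2.+2 k).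
  exists (s1 + s2 + s3 + s4) => t le; apply/and4P; split.
  - by apply H1; lia.
  - by apply H2; lia.
  - by apply H3; lia.
  - by apply H4; lia.
have [s Hs] := uniform_bound b stc.
have [s' Hs'] := st (cpair (string_code (restr A n)) 0).
(* Past the halting times of all queries involved, and long enough to contain the prefix on which
   the value is large. *)
pose c := s + s' + n; exists c.
have cc : c <= string_code (restr A c).
  by rewrite -[leqLHS](size_restr A c) size_string_code.
apply/exceedsP; split=> [z zb|].
  have h : halted_check a z (string_code (restr A c)).
    by apply: Hs => //; apply: leq_trans cc; rewrite /c; lia.
  by rewrite h (check_ext af h) fc.
exists n; rewrite ?size_restr; first by rewrite /c; lia.
rewrite take_restr; last by rewrite /c; lia.
have [h e] : stable (cpair (string_code (restr A n)) 0) (string_code (restr A c)).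
  by apply: Hs'; apply: leq_trans cc; rewrite /c; lia.
by rewrite /large h e.
Qed.

(** * Passing all checks and approximating a real martingale *)

Section CheckReal.
Local Open Scope ring_scope.
Variable R : realType.
Local Notation decoded := (@decoded R).

Lemma checkP f u k m : reflect
  (let v := decoded (f (cpair u k)) in
   let v01 := decoded (f (cpair u.*2.+1 k)) + decoded (f (cpair u.*2.+2 k)) in
   [/\ v <= decoded (f (cpair u m)) + (2^-1 ^+ k + 2^-1 ^+ m),
       0 <= v + 2^-1 ^+ k, v + v <= v01 + 4 * 2^-1 ^+ k
     & v01 <= v + v + 4 * 2^-1 ^+ k])
  (check f (cpair u (cpair k m))).
Proof.
rewrite /check !cpairE !(rle_decoded R) !radd_decoded !rdiv2n_decoded
  !rnat_decoded !mul1r.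
exact: and4P.
Qed.

Definition approximates (f : nat -> nat) (d : seq bool -> R) : Prop :=
  forall w k, `|d w - decoded (f (cpair (string_code w) k))| <= 2^-1 ^+ k.

Lemma computable_real_funP d :
  computable_real_fun d <-> exists2 f, computable f & approximates f d.
Proof.
split=> [[q [f cf qf] dq]|[f cf fd]].
  by exists f => // w k; rewrite /decoded -qf.
exists (fun w k => rat_decode (f (cpair (string_code w) k))) => //.
by exists f.
Qed.

Lemma approximates_check f d : martingale d -> approximates f d ->
  forall z, check f z.
Proof.
move=> [d0 dm] fd z; rewrite -[z]cpair_eta -[csnd z]cpair_eta.
have [w <-] := string_code_surj (cfst z).
apply/checkP => v v01.
have fd0 k := fd (rcons w false) k; have fd1 k := fd (rcons w true) k.
rewrite string_code_rcons addn1 in fd0; rewrite string_code_rcons addn2 in fd1.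
have := fd w (cfst (csnd z)); have := fd w (csnd (csnd z)).
have := fd0 (cfst (csnd z)); have := fd1 (cfst (csnd z)).
have := dm w; have := d0 w.
rewrite !ler_norml -/v /v01 => h0 hm /andP[??] /andP[??] /andP[??] /andP[??].
by split; lra.
Qed.

(** By the first inequality of [checkP], each lower estimate [v w k - 2^-k] is at most each upper
    estimate [v w m + 2^-m]; the supremum of the lower ones is the value sought. The other
    inequalities become nonnegativity and fairness as the precision grows. *)
Lemma check_approximates f : (forall z, check f z) ->
  exists2 d, martingale d & approximates f d.
Proof.
move=> fc; pose v w k := decoded (f (cpair (string_code w) k)).
have H w k m : [/\ v w k <= v w m + (2^-1 ^+ k + 2^-1 ^+ m),
    0 <= v w k + 2^-1 ^+ k,
    v w k + v w k <= v (rcons w false) k + v (rcons w true) k + 4 * 2^-1 ^+ k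
  & v (rcons w false) k + v (rcons w true) k <= v w k + v w k + 4 * 2^-1 ^+ k].
  have /checkP := fc (cpair (string_code w) (cpair k m)).
  by rewrite /v !string_code_rcons addn1 addn2.
pose S w : set R := [set x | exists k, x = v w k - 2^-1 ^+ k]%classic.
pose d w := sup (S w).
have ub w m : ubound (S w) (v w m + 2^-1 ^+ m).
  by move=> _ [k ->]; have [h _ _ _] := H w k m; lra.
have fd : approximates f d.
  move=> w k; rewrite -/(v w k) ler_distl; apply/andP; split.
    by apply: ub_le_sup; [exists (v w 0%N + 2^-1 ^+ 0); apply: ub | exists k].
  by apply: ge_sup; [exists (v w 0%N - 2^-1 ^+ 0), 0%N | apply: ub].
exists d => //; split=> w.
  rewrite leNgt; apply/negP => dn.
  have [k] := @pow_half_small R (- d w / 2) ltac:(lra).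
  have := fd w k; have [_ h _ _] := H w k k.
  by rewrite -/(v w k) ler_norml => /andP[? ?] ?; lra.
(* The constant 8 is 2 for the doubled value, 1 for each child, and the slack 4 of the check. *)
apply/eqP; rewrite -subr_eq0; apply/eqP; apply: (@squeeze_pow_half R _ 8) => k.
have := fd w k; have := fd (rcons w false) k; have := fd (rcons w true) k.
have [_ _ h1 h2] := H w k k.
rewrite -!/(v _ _) !ler_norml => /andP[? ?] /andP[? ?] /andP[? ?].
by apply/andP; split; lra.
Qed.

Lemma not_RAND_comp_program A : ~ RAND_comp R A <->
  exists f, [/\ computable f, forall z, check f z & unbounded_along f A].
Proof.
have step f d w : approximates f d ->
    d w - 1 <= decoded (f (cpair (string_code w) 0)) <= d w + 1.
  by move=> fd; have := fd w 0%N; rewrite expr0 ler_norml => /andP[? ?]; lra.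
split=> [/not_RAND_comp[d [md /computable_real_funP[f cf fd] unb]]|].
  exists f; split=> // [|b]; first exact: approximates_check fd.
  (* The extra 1 pays for the error of the precision-0 approximation; likewise in the converse. *)
  have [n dn] := unb b.+1; exists n.
  have /andP[+ _] := step _ _ (restr A n) fd.
  by rewrite (rle_decoded R) rnat_decoded; move: dn; rewrite -natr1; lra.
move=> [f [cf /check_approximates[d md fd] unb]]; apply/not_RAND_comp.
exists d; split=> // [|N]; first by apply/computable_real_funP; exists f.
have [n] := unb N.+1; rewrite (rle_decoded R) rnat_decoded -natr1 => h.
by exists n; have /andP[_] := step _ _ (restr A n) fd; lra.
Qed.

End CheckReal.

Lemma RAND_comp_Pi03 (R : realType) : lightface_Pi03 (RAND_comp R).
Proof.
exists (fun a b w => ~~ exceeds a b (string_code w)).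
  exists (fun x => nat_of_bool (~~ exceeds (cfst x) (cfst (csnd x)) (csnd (csnd x)))).
    exact: computable_negb computable_exceeds.
  by move=> a b w; rewrite !cpairE.
apply/seteqP; split=> A /= HA.
  move=> a; apply: contrapT => /forallNP H.
  suff : ~ RAND_comp R A by [].
  apply/not_RAND_comp_program/exceeds_program; exists a => b.
  by have /existsNP[c /negP/negPn] := H b; exists c.
apply: contrapT => /not_RAND_comp_program/exceeds_program[a H].
have [b Hb] := HA a; have [c] := H b.
by apply/negP.
Qed.

(** * Betting on a predictor *)

Lemma restr_eqP A B n : restr A n = restr B n <-> forall i, i < n -> A i = B i.
Proof.
split=> [e i lt|e].
  by have := congr1 (fun s => nth false s i) e; rewrite /restr !nth_mkseq.
by apply: (@eq_from_nth _ false); rewrite !size_restr // => i lt;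
  rewrite /restr !nth_mkseq // e.
Qed.

(** Otherwise there are points outside [U] agreeing with [A] on ever longer prefixes; they converge
    to [A] coordinatewise, hence in the product topology. *)
Lemma open_cylinder (U : set cantor_space) A : open U -> U A ->
  exists n, forall B, restr B n = restr A n -> U B.
Proof.
move=> oU UA; apply: contrapT => /forallNP H.
have {H} /choice[B HB] n : exists B, restr B n = restr A n /\ ~ U B.
  by have /existsNP[B /not_implyP] := H n; exists B.
have cvB : (B @ \oo --> A)%classic.
  apply/cvg_sup => i V [/= _ [[W /= oW <-] /= WA]] /filterS; apply.
  exists i.+1 => // n /= lt; have [/restr_eqP e _] := HB n.
  by rewrite /= e.
have [n _ /(_ n (leqnn n)) /=] : (\forall n \near \oo, U (B n))%classic.
  by apply: cvB; apply: open_nbhs_nbhs.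
by have [] := HB n.
Qed.

Section Betting.
Local Open Scope ring_scope.
Variable R : realType.

Definition computable_predictor (g : seq bool -> bool) : Prop :=
  exists2 f, computable f & forall w, f (string_code w) = g w.

Definition follow (g : seq bool -> bool) (w : seq bool) (k : nat) : seq bool :=
  iter k (fun w => rcons w (g w)) w.

Lemma size_follow g w k : size (follow g w k) = (size w + k)%N.
Proof. by elim: k => [|k IH]; rewrite ?addn0 //= size_rcons IH addnS. Qed.

Lemma prefix_follow g w k : prefix w (follow g w k).
Proof.
elim: k => [|k IH]; first exact: prefix_refl.
exact: prefix_trans IH (prefix_rcons _ _).
Qed.

(** The string is reversed so that its last bit is the head. The factor 4 is a doubled capital times
    the 2 from the normalization by [2^|w|]; the successor keeps the value positive, so that betting
    can restart at any length. *)
Fixpoint bet_rev (g : seq bool -> bool) (s : seq bool) : nat :=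
  if s is b :: s' then
    (if b == g (rev s') then 4 * bet_rev g s' else 0).+1
  else 1.

(* The martingale [(bet g w + 1) / 2^|w|] is the sum over n of 2^-n times the
   martingale that from length n on stakes its whole capital on the next bit
   being the one predicted by [g]. *)
Definition bet g w := bet_rev g (rev w).

Lemma bet_rcons g w b :
  bet g (rcons w b) = (if b == g w then 4 * bet g w else 0).+1%N.
Proof. by rewrite /bet rev_rcons /= revK. Qed.

Definition bet_martingale g (w : seq bool) : R :=
  (bet g w).+1%:R * 2^-1 ^+ size w.

Lemma bet_martingaleP g : martingale (bet_martingale g).
Proof.
split=> w; first by rewrite mulr_ge0 ?exprn_ge0 ?invr_ge0.
rewrite /bet_martingale !size_rcons !bet_rcons exprS.
case: (g w) => /=; rewrite -!natr1 natrM; by field.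
Qed.

Lemma computable_bet_martingale g :
  computable_predictor g -> computable_real_fun (bet_martingale g).
Proof.
move=> [fg cg fgE]; apply/computable_real_funP.
have [fb cb fbE] : exists2 f, computable f & forall w, f (string_code w) = bet g w.
  apply: (@computable_string_rec _
    (fun n b r => (if b == fg n then 4 * r else 0).+1)%N).
    apply: computable_succ; apply: computable_if; last by comp.
      apply: computable_eqn; first by comp.
      by apply: (computable_comp cg); comp.
    by comp.
  move=> w b; rewrite bet_rcons fgE.
  by case: b; case: (g w).
have [fs cs fsE] : exists2 f, computable f & forall w, f (string_code w) = size w.
  by apply: (@computable_string_rec _ (fun _ _ r => r.+1)) => [|w b];
    [comp | rewrite size_rcons].
exists (fun x => rdiv2n (rnat (fb (cfst x)).+1) (fs (cfst x))).
  apply: computable_rdiv2n; last by apply: (computable_comp cs); comp.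
  by apply/computable_rnat/computable_succ/(computable_comp cb); comp.
move=> w k; rewrite cfst_pair fbE fsE rdiv2n_decoded rnat_decoded subrr normr0.
by rewrite exprn_ge0 ?invr_ge0.
Qed.

Lemma bet_follow g w k : (4 ^ k <= bet g (follow g w k))%N.
Proof.
elim: k => [|k IH] /=; last by rewrite bet_rcons eqxx expnS leqW // leq_mul2l IH.
by case/lastP: w => // w b; rewrite bet_rcons.
Qed.

(** After [n + N] correct predictions from length [n] on, [bet] is at least [4^(n+N)] at length
    [2n + N], so the martingale is at least [2^N]. *)
Lemma follow_not_random g A : computable_predictor g ->
  (forall N, exists n m,
     restr A m = follow g (restr A n) (n + N)) ->
  ~ RAND_comp R A.
Proof.
move=> cg H; apply/not_RAND_comp; exists (bet_martingale g); split.
- exact: bet_martingaleP.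
- exact: computable_bet_martingale.
move=> N; have [n [m Hm]] := H N; exists m.
rewrite /bet_martingale Hm size_follow size_restr exprVn ler_pdivlMr ?exprn_gt0 //.
rewrite -natrX -natrM ler_nat; apply: leq_trans (leqnSn _).
apply: leq_trans (bet_follow _ _ _).
apply: leq_trans (leq_mul (ltnW (ltn_expl N (ltnSn 1))) (leqnn _)) _.
by rewrite (_ : 4 = 2 * 2)%N // expnMn -!expnD leq_exp2l //; lia.
Qed.

(* The additive term leaves enough room for a computable choice of a child on
   which the sum does not increase, although comparing two real values of [D]
   is undecidable. *)
Definition padded (D : seq bool -> R) (w : seq bool) : R :=
  D w + 4 * 2^-1 ^+ size w.

(** Take the child with the smaller approximation. At length [l] both errors are at most [2^-l], so
    [D] grows by at most [2^-l], while the padding drops by [2 * 2^-l]. *)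
Lemma padded_predictor D : martingale D -> computable_real_fun D ->
  exists2 g, computable_predictor g &
    forall w, padded D (rcons w (g w)) <= padded D w.
Proof.
move=> [D0 Dm] /computable_real_funP[f cf fD].
(* The code [c] of the parent doubles as the precision, being at least its length. *)
pose v c i := f (cpair (c.*2 + i)%N c).
pose h c := rle (v c 1%N) (v c 2%N).
exists (fun w => ~~ h (string_code w)).
  exists (fun c => nat_of_bool (~~ h c)) => //.
  have cv i : computable (v^~ i).
    by apply: (@computable_comp f (fun c => cpair (c.*2 + i)%N c)); comp.
  by apply: computable_negb; apply: computable_rle.
move=> w; rewrite /padded size_rcons exprS.
have Hb b := fD (rcons w b) (string_code w).
have := Hb false; have := Hb true; rewrite !string_code_rcons.
have le : 2^-1 ^+ string_code w <= 2^-1 ^+ size w :> R.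
  rewrite ler_wiXn2l ?invr_ge0 ?invf_le1 ?ler1n //; exact: size_string_code.
have e0 : 0 <= 2^-1 ^+ size w :> R by rewrite exprn_ge0 ?invr_ge0.
rewrite /h /v (rle_decoded R) !ler_norml => /andP[? ?] /andP[? ?].
by have := Dm w; case: (leP (decoded R _)) => /= ? ?; lra.
Qed.

End Betting.

(** * The lower bound *)

Section Avoidance.
Local Open Scope ring_scope.
Variable R : realType.
Local Notation approximates := (@approximates R).
Local Notation padded := (@padded R).

Lemma martingale_combine (D d : seq bool -> R) k : martingale D -> martingale d ->
  martingale (fun w => D w + d w * 2^-1 ^+ k).
Proof.
move=> [D0 Dm] [d0 dm]; split=> w.
  by rewrite addr_ge0 ?mulr_ge0 ?exprn_ge0 ?invr_ge0.
by rewrite mulrDr Dm mulrA dm mulrDl addrACA.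
Qed.

Lemma computable_combine (D d : seq bool -> R) k :
  computable_real_fun D -> computable_real_fun d ->
  computable_real_fun (fun w => D w + d w * 2^-1 ^+ k).
Proof.
move=> /computable_real_funP[fD cD aD] /computable_real_funP[fd cd ad].
apply/computable_real_funP.
(* One more bit of precision on both summands: the scaling factor is at most 1, so the two errors
   add up to at most [2^-n]. *)
pose up x := cpair (cfst x) (csnd x).+1.
exists (fun x => radd (fD (up x)) (rdiv2n (fd (up x)) k)).
  have cup : computable up by rewrite /up; comp.
  apply: computable_radd; first exact: (computable_comp cD cup).
  by apply: computable_rdiv2n; [exact: (computable_comp cd cup) | comp].
move=> w n; rewrite /up !cpairE radd_decoded rdiv2n_decoded.
have := aD w n.+1; have := ad w n.+1.
move: (decoded _ _) (decoded _ _) => Q q hq hQ.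
have -> : D w + d w * 2^-1 ^+ k - (Q + q * 2^-1 ^+ k) =
  (D w - Q) + (d w - q) * 2^-1 ^+ k by ring.
apply: le_trans (ler_normD _ _) _; rewrite normrM.
have k1 : `|2^-1 ^+ k| <= 1 :> R.
  by rewrite ger0_norm ?exprn_ge0 ?invr_ge0 // exprn_ile1 ?invr_ge0 ?invf_le1 ?ler1n.
have := ler_pM (normr_ge0 _) (normr_ge0 _) hq k1; move: hQ.
by rewrite mulr1 !exprS; lra.
Qed.

(** A noneffective list indexed by programs: a program approximates at most one martingale, and one
    that approximates none is assigned the zero martingale. *)
Lemma computable_martingale_seq : exists dd : nat -> seq bool -> R,
  (forall j, martingale (dd j) /\ computable_real_fun (dd j)) /\
  forall d, martingale d -> computable_real_fun d -> exists j, dd j = d.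
Proof.
pose Q a (d : seq bool -> R) :=
  martingale d /\ exists2 f, computes a f & approximates f d.
pose zero : seq bool -> R := fun=> 0.
have mz : martingale zero by split=> w; rewrite /zero ?mulr0 ?addr0.
have cz : computable_real_fun zero.
  apply/computable_real_funP; exists (fun=> rnat 0); first by comp.
  by move=> w k; rewrite rnat_decoded subrr normr0 exprn_ge0 ?invr_ge0.
have uniq a d d' : Q a d -> Q a d' -> d = d'.
  move=> [_ [f af fd]] [_ [f' af' fd']]; apply/funext => w; apply/eqP.
  rewrite -subr_eq0; apply/eqP; apply: (@squeeze_pow_half R _ 2) => k.
  have ff' z : f z = f' z.
    have [s [hs <-]] := af z; have [t [ht <-]] := af' z; exact: out_halted.
  have := fd w k; have := fd' w k; rewrite ff' !ler_norml.
  by move=> /andP[? ?] /andP[? ?]; apply/andP; split; lra.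
have /choice[dd Hdd] a : exists d, (martingale d /\ computable_real_fun d) /\
    forall d', Q a d' -> d = d'.
  have [[d Qd]|no] := pselect (exists d, Q a d).
    exists d; split; last by move=> d'; apply: uniq Qd.
    have [md [f af fd]] := Qd; split=> //; apply/computable_real_funP.
    by exists f => //; apply: computes_computable af.
  by exists zero; split=> // d' Qd'; case: no; exists d'.
exists dd; split=> [j|d md /computable_real_funP[f /computable_computes[a af] fd]].
  by have [] := Hdd j.
by exists a; have [_] := Hdd a; apply; split=> //; exists f.
Qed.

(** * Strings and sequences along which a function stays below 1 *)

Implicit Types (N : seq bool -> R) (s t : seq bool) (A B : cantor_space).

Definition below N s t : Prop :=
  prefix s t /\ forall u, prefix s u -> prefix u t -> N u < 1.

Definition stays_below N s A : Prop :=
  restr A (size s) = s /\ forall n, (size s <= n)%N -> N (restr A n) < 1.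

Lemma prefix_comparable s t u :
  prefix s u -> prefix t u -> (size s <= size t)%N -> prefix s t.
Proof. by rewrite !prefixE => /eqP su /eqP tu le; rewrite -tu take_takel // su. Qed.

(** The function may increase at [t], as it does in the construction each time a new martingale is
    added. *)
Lemma below_trans N N' s t u : (forall w, N w <= N' w) ->
  below N s t -> below N' t u -> below N s u.
Proof.
move=> NN' [st Hst] [tu Htu]; split; first exact: prefix_trans tu.
move=> v sv vu; case: (leqP (size v) (size t)) => [vt|/ltnW tv].
  exact: Hst (prefix_comparable vu tu vt).
apply: le_lt_trans (NN' _) (Htu _ _ vu).
exact: prefix_comparable vu tv.
Qed.

Lemma below_refl N s : N s < 1 -> below N s s.
Proof.
move=> Ns; split=> [|u su us]; first exact: prefix_refl.
move: su us; rewrite !prefixE => /eqP su /eqP us.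
suff -> : u = s by [].
case: (leqP (size s) (size u)) => [le|/ltnW le].
  by rewrite -us take_oversize.
by rewrite -su take_oversize.
Qed.

Lemma below_last N s t : below N s t -> N t < 1.
Proof. by move=> [st]; apply=> //; exact: prefix_refl. Qed.

Lemma below_follow N g s k : (forall w, N (rcons w (g w)) <= N w) -> N s < 1 ->
  below N s (follow g s k).
Proof.
move=> Ng Ns; elim: k => [|k IH] /=; first exact: below_refl.
have := below_last IH; move: IH; rewrite -/(follow g s k); move: (follow g s k) => t IH Nt.
apply: below_trans IH _ => //; split=> [|u]; first exact: prefix_rcons.
rewrite !prefixE => /eqP tu.
case: (ltnP (size t) (size u)) => [lt|le].
  by rewrite take_oversize ?size_rcons // => /eqP <-; apply: le_lt_trans Nt.
by move=> _; rewrite -tu take_oversize in Nt.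
Qed.

Lemma restr_prefix A m n : (m <= n)%N -> prefix (restr A m) (restr A n).
Proof. by move=> mn; rewrite prefixE size_restr take_restr. Qed.

Lemma stays_below_restr N s A n : (size s <= n)%N ->
  stays_below N s A -> below N s (restr A n).
Proof.
move=> sn [As HA]; split=> [|u su uA]; first by rewrite -As restr_prefix.
have un : (size u <= n)%N by rewrite -(size_restr A n) size_prefix.
move: uA; rewrite prefixE take_restr // => /eqP <-.
by apply: HA; exact: size_prefix.
Qed.

Lemma stays_below_cons N N' s t A : (forall w, N w <= N' w) -> below N s t ->
  stays_below N' t A -> stays_below N s A.
Proof.
move=> NN' [st Hst] [At HA]; split.
  have := size_prefix st => le; rewrite -(take_restr _ le) At.
  by move: st; rewrite prefixE => /eqP.
move=> n sn; case: (leqP (size t) n) => [tn|/ltnW nt].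
  exact: le_lt_trans (NN' _) (HA _ tn).
have nA : restr A n = take n t by rewrite -At take_restr.
apply: Hst; rewrite nA; last exact: prefix_take.
move: st; rewrite !prefixE take_takel //.
Qed.

Lemma prefix_chain_limit (tau : nat -> seq bool) :
  (forall k, prefix (tau k) (tau k.+1)) -> (forall n, exists k, (n <= size (tau k))%N) ->
  exists A : cantor_space, forall k, restr A (size (tau k)) = tau k.
Proof.
move=> tauS /choice[K HK].
have mono k l : (k <= l)%N -> prefix (tau k) (tau l).
  move=> /subnK <-; elim: (l - k)%N => [|i IH]; first exact: prefix_refl.
  exact: prefix_trans IH (tauS _).
have nthE k l i : (i < size (tau k))%N -> (i < size (tau l))%N ->
    nth false (tau k) i = nth false (tau l) i.
  wlog kl : k l / (k <= l)%N => [H ik il|ik _].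
    by case/orP: (leq_total k l) => ?; [|apply/esym]; apply: H.
  by have := mono _ _ kl; rewrite prefixE => /eqP <-; rewrite nth_take.
exists (fun i => nth false (tau (K i.+1)) i) => k.
apply: (@eq_from_nth _ false); rewrite size_restr // => i ik.
by rewrite /restr nth_mkseq //; apply: nthE.
Qed.

(* Baire category inside the closed set of sequences along which [padded D]
   stays below 1: there, the sequences that follow the predictor on infinitely
   many long stretches form a comeager set of non-random sequences. *)
Lemma avoid_Gdelta (U : nat -> set cantor_space) (D : seq bool -> R) s :
  (forall k, open (U k)) -> (\bigcap_k U k `<=` RAND_comp R)%classic ->
  martingale D -> computable_real_fun D -> padded D s < 1 ->
  exists k t, below (padded D) s t /\
    forall A, stays_below (padded D) t A -> ~ U k A.
Proof.
move=> oU UR mD cD Ns; have [g cg Ng] := padded_predictor mD cD.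
apply: contrapT => no.
(* Failure of the claim makes every [U k] dense in the closed set. *)
have hit k t : below (padded D) s t -> exists2 A, stays_below (padded D) t A & U k A.
  move=> st; apply: contrapT => noA; apply: no; exists k, t; split=> // A At UA.
  by apply: noA; exists A.
(* From [t], follow the predictor for [size t + k] steps, the amount that [follow_not_random] asks
   for, then extend within the closed set into a cylinder contained in [U k]. *)
have next (kt : nat * seq bool) : exists t', below (padded D) s kt.2 ->
    [/\ below (padded D) s t', prefix (follow g kt.2 (size kt.2 + kt.1)) t'
      & forall A, restr A (size t') = t' -> U kt.1 A].
  case: kt => k t /=; have [st|] := pselect (below (padded D) s t); last by exists t.
  set t1 := follow g t _.
  have st1 : below (padded D) s t1.
    by apply: (below_trans _ st) => //; apply: below_follow (below_last st).
  have [A At1 UA] := hit k t1 st1.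
  have [m Hm] := open_cylinder (oU k) UA.
  exists (restr A (maxn m (size t1))) => _; split.
  - apply: (below_trans _ st1) => //.
    by apply: stays_below_restr At1; rewrite leq_maxr.
  - have [e _] := At1; rewrite -[X in prefix X _]e.
    by rewrite restr_prefix // leq_maxr.
  - move=> B; rewrite size_restr => BA; apply: Hm.
    by rewrite -(take_restr B (leq_maxl m (size t1))) BA take_restr ?leq_maxl.
have [F HF] := choice next.
pose tau := fix tau k := if k is k'.+1 then F (k', tau k') else s.
have st k : below (padded D) s (tau k).
  elim: k => [|k IH] /=; first exact: below_refl.
  by have [] := HF (k, tau k) IH.
have Htau k : prefix (follow g (tau k) (size (tau k) + k)) (tau k.+1) /\
    forall A, restr A (size (tau k.+1)) = tau k.+1 -> U k A.
  by have [] := HF (k, tau k) (st k).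
have [A HA] : exists A : cantor_space, forall k, restr A (size (tau k)) = tau k.
  apply: prefix_chain_limit => [k|n].
    by have [+ _] := Htau k; apply: prefix_trans; exact: prefix_follow.
  exists n.+1; have [/size_prefix + _] := Htau n; rewrite size_follow.
  by apply: leq_trans; lia.
have /UR : (\bigcap_k U k)%classic A.
  by move=> k _; have [_] := Htau k; apply; apply: HA.
apply: follow_not_random cg _ => N.
exists (size (tau N)), (size (tau N) + (size (tau N) + N))%N.
rewrite HA; have [pf _] := Htau N.
have := size_prefix pf; rewrite size_follow => le.
rewrite -(take_restr _ le) HA; move: pf.
by rewrite prefixE size_follow => /eqP.
Qed.

(** Since [d] is nonnegative, staying below 1 for [D'] implies it for [D]; so adding a small
    multiple of [d] preserves the avoidance of [G] already secured for [D]. *)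
Lemma defeat_step (G : set cantor_space) (d D : seq bool -> R) s :
  Gdelta G -> (G `<=` RAND_comp R)%classic ->
  martingale d -> computable_real_fun d ->
  martingale D -> computable_real_fun D -> padded D s < 1 ->
  exists k t, let D' := fun w => D w + d w * 2^-1 ^+ k in
  [/\ below (padded D) s t, (size s < size t)%N, padded D' t < 1
    & forall A, stays_below (padded D') t A -> ~ G A].
Proof.
move=> [U oU ->] GR md cd mD cD Ns.
have [j [t0 [st0 Ht0]]] := avoid_Gdelta oU GR mD cD Ns.
have [g _ Ng] := padded_predictor mD cD.
have t0t := below_follow 1 Ng (below_last st0).
(* One further bit makes [t] strictly longer than [s], so that the strings of the construction have
   a limit. *)
pose t := follow g t0 1; rewrite -/t in t0t.
have dt0 : 0 < d t + 1 by have [d0 _] := md; have := d0 t; lra.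
have Nt := below_last t0t.
(* The scaled [d t] must fit into the remaining gap below 1; [d t + 1] replaces [d t], which may
   vanish. *)
have [k Hk] := @pow_half_small R ((1 - padded D t) / (d t + 1))
  ltac:(by rewrite divr_gt0 // subr_gt0).
have p0 : 0 <= 2^-1 ^+ k :> R by rewrite exprn_ge0 ?invr_ge0.
exists k, t; split.
- exact: below_trans st0 t0t.
- have [/size_prefix + _] := st0; by rewrite size_follow addn1 ltnS.
- by move: Hk; rewrite ltr_pdivlMr // /padded /=; lra.
- move=> A At GA; apply: (Ht0 A); last exact: GA.
  apply: stays_below_cons t0t At => w; rewrite /padded /=.
  by have [d0 _] := md; have := mulr_ge0 (d0 w) p0; lra.
Qed.

Theorem RAND_comp_not_Sigma03 : ~ boldface_Sigma03 (RAND_comp R).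
Proof.
move=> [G GG RG].
have GR i : (G i `<=` RAND_comp R)%classic by rewrite RG => A GA; exists i.
have [dd [ddP dd_all]] := computable_martingale_seq.
pose good (x : (seq bool -> R) * seq bool) :=
  [/\ martingale x.1, computable_real_fun x.1 & padded x.1 x.2 < 1].
have /choice[F HF] (ix : nat * ((seq bool -> R) * seq bool)) :
    exists kt : nat * seq bool, good ix.2 ->
    let D' := fun w => ix.2.1 w + dd ix.1 w * 2^-1 ^+ kt.1 in
    [/\ below (padded ix.2.1) ix.2.2 kt.2, (size ix.2.2 < size kt.2)%N,
      padded D' kt.2 < 1 & forall A, stays_below (padded D') kt.2 A -> ~ G ix.1 A].
  case: ix => i [D s] /=.
  have [[/= mD cD Ns]|] := pselect (good (D, s)); last by exists (0%N, [::]).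
  have [md cd] := ddP i.
  have [k [t H]] := defeat_step (GG i) (GR i) md cd mD cD Ns.
  by exists (k, t).
pose next i x := let kt := F (i, x) in
  ((fun w => x.1 w + dd i w * 2^-1 ^+ kt.1), kt.2).
(* For the zero martingale only the padding counts; at length 3 it is [4/8 < 1]. *)
pose st := fix st i := if i is i'.+1 then next i' (st i')
  else ((fun=> 0) : seq bool -> R, nseq 3 false).
have goodst i : good (st i).
  elim: i => [|i IH].
    split=> //=; last by rewrite /padded /= add0r; lra.
      by split=> w; rewrite ?mulr0 ?addr0.
    apply/computable_real_funP; exists (fun=> rnat 0); first by comp.
    by move=> w k; rewrite rnat_decoded subrr normr0 exprn_ge0 ?invr_ge0.
  have [mD cD Ns] := IH; have [md cd] := ddP i.
  have [_ _ Nt _] := HF (i, st i) IH; split => //.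
    exact: martingale_combine.
  exact: computable_combine.
have stP i : [/\ below (padded (st i).1) (st i).2 (st i.+1).2,
    (size (st i).2 < size (st i.+1).2)%N
  & forall A, stays_below (padded (st i.+1).1) (st i.+1).2 A -> ~ G i A].
  by have [? ? _ ?] := HF (i, st i) (goodst i).
have coefE i : exists2 e, 0 < e &
    forall w, (st i.+1).1 w = (st i).1 w + dd i w * e.
  by exists (2^-1 ^+ (F (i, st i)).1); rewrite ?exprn_gt0 ?invr_gt0.
have size_st n : (n <= size (st n).2)%N.
  by elim: n => // n IH; have [_ lt _] := stP n; apply: leq_ltn_trans IH lt.
have [A HA] : exists A : cantor_space, forall i, restr A (size (st i).2) = (st i).2.
  apply: (@prefix_chain_limit (fun i => (st i).2)) => [i|n]; last by exists n.
  by have [[]] := stP i.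
have coef_ge0 i w e : 0 < e -> 0 <= dd i w * e.
  by move=> /ltW e0; have [[d0 _] _] := ddP i; apply: mulr_ge0.
have padded_le i j : (i <= j)%N ->
    forall w, padded (st i).1 w <= padded (st j).1 w.
  move=> /subnK <-; elim: (j - i)%N => [|l IH] w //.
  apply: le_trans (IH w) _; have [e e0] := coefE (l + i)%N.
  by rewrite /padded addSn => ->; have := coef_ge0 (l + i)%N w e e0; lra.
have chain i j : (i <= j)%N -> below (padded (st i).1) (st i).2 (st j).2.
  move=> ij; rewrite -(subnK ij); elim: (j - i)%N => [|l IH].
    by apply: below_refl; have [] := goodst i.
  have [+ _ _] := stP (l + i)%N; apply: below_trans IH.
  by apply: padded_le; apply: leq_addl.
have stay i : stays_below (padded (st i).1) (st i).2 A.
  split=> // n le; have [_ H] := chain i (maxn i n) (leq_maxl _ _).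
  have nj : (n <= size (st (maxn i n)).2)%N.
    by apply: leq_trans (size_st _); apply: leq_maxr.
  by apply: H; rewrite -HA; apply: restr_prefix.
have rA : RAND_comp R A.
  apply: contrapT => /not_RAND_comp[d [md cd unb]].
  have [i di] := dd_all d md cd; have [e e0 He] := coefE i.
  pose m := size (st i.+1).2.
  (* [d] enters the sum with weight [e > 0], so [d <= 1/e] along [A] from length [m] on; the finite
     sum covers the shorter prefixes. *)
  pose S := e^-1 + \sum_(n < m) d (restr A n).
  have [d0 _] := md.
  have S0 : 0 <= \sum_(n < m) d (restr A n) by apply: sumr_ge0.
  have [n] := unb (Num.truncn S).+1; apply/negP; rewrite -ltNge.
  apply: le_lt_trans (truncnS_gt S).
  case: (ltnP n m) => [nm|mn].
    rewrite /S (bigD1 (Ordinal nm)) //= addrCA lerDl.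
    by apply: addr_ge0; [rewrite invr_ge0 ltW | apply: sumr_ge0].
  apply: le_trans (_ : e^-1 <= _); last by rewrite lerDl.
  rewrite -[e^-1]mul1r ler_pdivlMr //.
  have [_ /(_ n mn)] := stay i.+1; rewrite /padded He di => lt.
  have [[D0 _] _ _] := goodst i; have := D0 (restr A n).
  have : 0 <= 2^-1 ^+ size (restr A n) :> R by rewrite exprn_ge0 ?invr_ge0.
  by lra.
(* [A] would lie in some [G i], contrary to the choice made at stage [i]. *)
move: (rA); rewrite RG => -[i _].
by have [_ _] := stP i; apply; apply: stay.
Qed.

End Avoidance.

Theorem mainTheorem17 (R : realType) :
  lightface_Pi03 (RAND_comp R) /\ ~ boldface_Sigma03 (RAND_comp R).
Proof. by split; [exact: RAND_comp_Pi03 | exact: RAND_comp_not_Sigma03]. Qed.
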